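(* Let $(W,S)$ be a Coxeter system. For every $s\in S$ let $d_s=[W:W_{S\setminus\{s\}}]\in\{2,3,\dots\}\cup\{\infty\}$ be the index of the parabolic subgroup generated by $S\setminus\{s\}$, and let $q_s$ be a real number with $$\frac{-1}{d_s-1}\le q_s\le 1,$$ where $\frac{-1}{d_s-1}$ is understood as $0$ if $d_s=\infty$. Then the Riesz–Coxeter function $R_{\mathbf q}$, $\mathbf q=(q_s)_{s\in S}$, is positive definite on $W$.
   Context: A Coxeter system $(W,S)$ is a group $W$ with a (possibly infinite) generating set $S$ and presentation $W=\langle S\mid (s_1s_2)^{m(s_1,s_2)}=1 \text{ whenever } m(s_1,s_2)\neq\infty\rangle$, where $m\colon S\times S\to\{1,2,\dots,\infty\}$ is symmetric and $m(s_1,s_2)=1$ iff $s_1=s_2$. For $T\subseteq S$, $W_T$ is the subgroup of $W$ generated by $T$. For $w\in W$ the colour $S_w\subseteq S$ is the (finite) set of generators occurring in a reduced word of $w$ (it does not depend on the reduced word; $s\in S_w$ iff $w\notin W_{S\setminus\{s\}}$). The Riesz–Coxeter function is $R_{\mathbf q}(w)=\prod_{s\in S_w}q_s$ (so $R_{\mathbf q}(e)=1$). A function $\varphi\colon W\to\mathbb{C}$ is positive definite if $\sum_{x,y\in W}\varphi(y^{-1}x)\alpha(x)\overline{\alpha(y)}\ge 0$ for every finitely supported $\alpha\colon W\to\mathbb{C}$. *)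

(* Defs.v *)
From HB Require Import structures.
From mathcomp Require Import all_boot all_order all_algebra finmap.
From mathcomp Require Import boolp classical_sets functions cardinality.
From mathcomp Require Import reals complex.

Set Implicit Arguments.
Unset Strict Implicit.
Unset Printing Implicit Defensive.

Import Order.TTheory GRing.Theory Num.Theory.

Local Open Scope classical_set_scope.
Local Open Scope group_scope.

(* A word in the letters x and x^-1, x : I; the letter (x, true) is x^-1. *)
Definition gword (I : Type) : Type := seq (I * bool).

Definition geval (W : groupType) (I : Type) (f : I -> W) (u : gword I) : W :=
  \prod_(l <- u) (if l.2 then (f l.1)^-1 else f l.1).

(* The congruence on words generated by free cancellation and by Rel = 1; its
   quotient is the free group on I modulo the normal closure of Rel. *)
Inductive pres_eq (I : Type) (Rel : set (gword I)) :
    gword I -> gword I -> Prop :=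
| pres_refl u : pres_eq Rel u u
| pres_sym u v : pres_eq Rel u v -> pres_eq Rel v u
| pres_trans u v w : pres_eq Rel u v -> pres_eq Rel v w -> pres_eq Rel u w
| pres_cat u u' v v' :
    pres_eq Rel u u' -> pres_eq Rel v v' -> pres_eq Rel (u ++ v) (u' ++ v')
| pres_cancel x b : pres_eq Rel [:: (x, b); (x, ~~ b)] [::]
| pres_rel r : Rel r -> pres_eq Rel r [::].

(* W = < I | Rel > along f. *)
Definition presents (W : groupType) (I : Type) (f : I -> W)
    (Rel : set (gword I)) : Prop :=
  (forall x : W, exists u, geval f u = x) /\
  (forall u, geval f u = 1 <-> pres_eq Rel u [::]).

Section Coxeter.
Variables (W : groupType) (S : set W).

(* In m and in indices, None stands for infinity. *)
Definition coxeter_matrix (m : S -> S -> option nat) : Prop :=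
  [/\ forall s t, m s t = m t s,
      forall s t, m s t <> Some 0%N
    & forall s t, m s t = Some 1%N <-> s = t].

Definition coxeter_relators (m : S -> S -> option nat) : set (gword S) :=
  [set r | exists s t k, m s t = Some k /\
             r = flatten (nseq k [:: (s, false); (t, false)])].

Definition coxeter_system (m : S -> S -> option nat) : Prop :=
  coxeter_matrix m /\ presents (fun s : S => \val s) (coxeter_relators m).

(* The subgroup W_T generated by T, a subset of S. *)
Definition parabolic (T : set S) : set W :=
  smallest (fun H : set W => group_closed (mem H)) [set \val s | s in T].

Definition eval_word (r : seq S) : W := \prod_(s <- r) \val s.

(* r is a reduced word of w. Positive letters suffice, since s^-1 = s. *)
Definition reduced_word (w : W) (r : seq S) : Prop :=
  eval_word r = w /\ forall r', eval_word r' = w -> size r <= size r'.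

Definition colour (w : W) : set S :=
  [set s | exists2 r, reduced_word w r & s \in r].

End Coxeter.

Definition left_cosets (W : groupType) (H : set W) : set (set W) :=
  range (fun x => [set x * h | h in H]).

Definition subgroup_index (W : groupType) (H : set W) : option nat :=
  if `[< finite_set (left_cosets H) >] then Some #|` fset_set (left_cosets H)|
  else None.

Local Open Scope ring_scope.

Definition riesz_bound (R : realType) (d : option nat) : R :=
  if d is Some n then - 1 / (n%:R - 1) else 0.

(* fset_set is the empty set on infinite sets, but colours are finite. *)
Definition riesz_coxeter (R : realType) (W : groupType) (S : set W)
    (q : S -> R) (w : W) : R :=
  \prod_(s <- fset_set (colour (S := S) w)) q s.

(* On R[i], 0 <= z means that z is real and nonnegative. *)
Definition positive_definite (R : realType) (W : groupType)
    (phi : W -> R[i]) : Prop :=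
  forall alpha : {fsfun W -> R[i] with 0},
    0 <= \sum_(x <- finsupp alpha) \sum_(y <- finsupp alpha)
           phi (y^-1 * x)%g * alpha x * (alpha y)^*%C.

(* Main.v *)
Require Import Defs.
From mathcomp Require Import all_boot all_order all_algebra finmap.
From mathcomp Require Import boolp classical_sets functions cardinality.
From mathcomp Require Import reals complex.
From mathcomp Require Import ring lra.

Set Implicit Arguments.
Unset Strict Implicit.
Unset Printing Implicit Defensive.

Import Order.TTheory GRing.Theory Num.Theory.

Local Open Scope classical_set_scope.
Local Open Scope ring_scope.

(** The colour of w consists of the s with w outside W_{S - s}, so R_q is the
pointwise product over s of the functions equal to 1 on W_{S - s} and to q_s
elsewhere; for the finitely many values y^-1 x that enter one instance of
positive definiteness, finitely many s suffice. It remains to see that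
multiplying a positive semidefinite kernel by one such factor keeps it positive
semidefinite.

The factor for s, as a kernel in (x, y), compares labels: it is 1 if x and y
lie in the same left coset of W_{S - s} and q = q_s otherwise. If the points in
play meet n cosets, then, 1_C being the indicator of the coset C,
  [xH = yH] + q [xH <> yH]
    = (1 - q) \sum_C (1_C(x) - 1/n) (1_C(y) - 1/n) + (1 + (n - 1) q) / n,
a combination of rank-one kernels whose coefficients are nonnegative as soon as
-1/(n-1) <= q <= 1 [centred_indicator_gram]. Since n is at most the
index d_s, the hypothesis on q_s provides this bound. Writing the factor as a
sum of rank-one kernels makes the Schur product theorem unnecessary: multiplying
by f(x) f(y) only rescales the coefficients alpha [psd_kernel_labels].

The description of the colour [colourP] is where the Coxeter relations enter.
To a word s_1 ... s_k one attaches the reflections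
t_i = s_1 ... s_{i-1} s_i s_{i-1} ... s_1. The parity of the number of times a
given t occurs among them depends only on the element that the word represents:
this is checked on the relators, where the sequence of reflections of (s s')^k
is periodic with period k and length 2 k [parity_alternating]. For a reduced
word the t_i are distinct [minimal_word_uniq], hence each of them occurs among
the reflections of every other word of the same element. So if w lies in W_T,
all t_i of a reduced word of w lie in W_T, and then so do all its letters; and a
generator in W_T belongs to T. *)

(** * Reflections attached to a word *)

Section Reflections.
Local Open Scope group_scope.
Variables (W : groupType) (I : Type) (f : I -> W).
Implicit Types (u v : gword I) (t : W).

(** The letter (i, true) contributes f i rather than its inverse: with this
choice the two reflections of a cancelling pair coincide even when f i is not an
involution. The conjugation x ^ y is y^-1 x y, so prefixes act by inverses. *)
Fixpoint reflections u : seq W :=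
  if u is (i, b) :: u' then
    f i :: [seq t ^ (if b then f i else (f i)^-1) | t <- reflections u']
  else [::].

Lemma geval_cons i b u :
  geval f ((i, b) :: u) = (if b then (f i)^-1 else f i) * geval f u.
Proof. by rewrite /geval big_cons. Qed.

Lemma geval_cat u v : geval f (u ++ v) = geval f u * geval f v.
Proof. by rewrite /geval big_cat. Qed.

Lemma reflections_cat u v : reflections (u ++ v) =
  reflections u ++ [seq t ^ (geval f u)^-1 | t <- reflections v].
Proof.
elim: u => [|[i b] u IH] /=.
  rewrite /geval big_nil invg1 (eq_map (@conjg1 W)) map_id //.
rewrite IH map_cat -map_comp; congr (_ :: _ ++ _); apply: eq_map => t /=.
by rewrite geval_cons invgM conjgM; case: b; rewrite ?invgK.
Qed.

Lemma count_conj t x (r : seq W) :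
  count_mem t [seq y ^ x^-1 | y <- r] = count_mem (t ^ x) r.
Proof.
rewrite count_map; apply: eq_count => y /=.
by rewrite -(inj_eq (conjg_inj x)) -conjgM mulVg conjg1.
Qed.

Definition parity t u : bool := odd (count_mem t (reflections u)).

Lemma parity_cat t u v :
  parity t (u ++ v) = parity t u (+) parity (t ^ geval f u) v.
Proof. by rewrite /parity reflections_cat count_cat oddD count_conj. Qed.

(** Evaluation and parities are compatible with concatenation and with
cancellation, so that only the relators are left to examine: this is how a
presentation yields an invariant of group elements without a group action being
built. *)
Lemma pres_eq_parity (Rel : set (gword I)) :
  (forall r, Rel r -> geval f r = 1 /\ forall t, ~~ parity t r) ->
  forall u v, pres_eq Rel u v ->
    geval f u = geval f v /\ forall t, parity t u = parity t v.
Proof.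
move=> relP u v; elim=> {u v}.
- by [].
- by move=> u v _ [-> E]; split.
- by move=> u v w _ [-> E] _ [-> E']; split=> // t; rewrite E E'.
- move=> u u' v v' _ [Eu Pu] _ [Ev Pv]; rewrite !geval_cat Eu Ev; split=> // t.
  by rewrite !parity_cat Eu Pu Pv.
- move=> i b; split.
    rewrite !geval_cons /geval big_nil mulg1.
    by case: b; rewrite /= ?mulgV ?mulVg.
  move=> t; rewrite /parity /=.
  have -> : f i ^ (if b then f i else (f i)^-1) = f i.
    by case: b; rewrite conjgE ?mulKg // mulgV mulg1 invgK.
  by rewrite /= addn0 addnn odd_double.
- move=> r /relP[-> E]; split=> [|t]; first by rewrite /geval big_nil.
  by rewrite (negPf (E t)).
Qed.


Definition alternating k (i j : I) : gword I :=
  flatten (nseq k [:: (i, false); (j, false)]).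

Lemma geval_alternating k i j : geval f (alternating k i j) = (f i * f j) ^+ k.
Proof.
elim: k => [|k IH]; first by rewrite /geval big_nil expg0.
by rewrite /alternating /= !geval_cons /= IH expgS mulgA.
Qed.

(** In the dihedral group generated by f i and f j the reflections met along the
word i j i j ... are c^n (f i) for n = 0, 1, 2, ..., with c = (f i)(f j). *)
Lemma reflections_alternating k i j : f i * f i = 1 -> f j * f j = 1 ->
  reflections (alternating k i j) =
  [seq (f i * f j) ^+ n * f i | n <- iota 0 (k + k)].
Proof.
move=> ii jj; have iV := mulg1_eq ii; have jV := mulg1_eq jj.
elim: k => // k IH; rewrite addSn addnS.
rewrite -[alternating _ _ _]/([:: (i, false); (j, false)] ++ alternating k i j).
rewrite reflections_cat IH /= expg0 expg1 mul1g /conjg invgK iV mulgA.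
congr [:: _, _ & _]; rewrite -[iota 2 _]/(iota (2 + 0) _) iotaDl -!map_comp.
apply: eq_map => n /=; rewrite !geval_cons /= /geval big_nil mulg1 invgK.
have -> : (f i * f j) ^+ n.+2 = f i * f j * ((f i * f j) ^+ n * (f i * f j)).
  by rewrite expgS expgSr.
by rewrite invgM iV jV !mulgA.
Qed.

(** When c^k = 1 the sequence c^n (f i), n < 2 k, runs twice through the same k
terms. *)
Lemma parity_alternating k i j t : f i * f i = 1 -> f j * f j = 1 ->
  (f i * f j) ^+ k = 1 -> ~~ parity t (alternating k i j).
Proof.
move=> ii jj ck; rewrite /parity reflections_alternating //.
have periodic : [seq (f i * f j) ^+ n * f i | n <- iota k k] =
                [seq (f i * f j) ^+ n * f i | n <- iota 0 k].
  rewrite -[X in iota X]addn0 iotaDl -map_comp; apply: eq_map => n /=.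
  by rewrite expgnDr ck mul1g.
by rewrite iotaD add0n map_cat periodic count_cat oddD addbb.
Qed.

End Reflections.

(** * Reduced words and parabolic subgroups of a Coxeter system *)

Section CoxeterWords.
Local Open Scope group_scope.
Variables (W : groupType) (S : set W) (m : S -> S -> option nat).
Hypothesis coxW : coxeter_system m.
Implicit Types (r : seq S) (w t : W) (P : pred S).

Local Notation gen := (fun s : S => \val s).

Definition positive_word r : gword S := [seq (s, false) | s <- r].

Lemma geval_positive_word r : geval gen (positive_word r) = eval_word r.
Proof. by rewrite /geval /eval_word /positive_word big_map. Qed.

Lemma eval_word_cons s r : eval_word (s :: r) = \val s * eval_word r.
Proof. by rewrite /eval_word big_cons. Qed.

Lemma eval_word_nil : eval_word ([::] : seq S) = 1.
Proof. by rewrite /eval_word big_nil. Qed.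

Lemma eval_word_cat r r' : eval_word (r ++ r') = eval_word r * eval_word r'.
Proof. by rewrite /eval_word big_cat. Qed.

Lemma relator_eval1 (u : gword S) : coxeter_relators m u -> geval gen u = 1.
Proof. by move=> mr; apply/coxW.2.2; apply: pres_rel. Qed.

Lemma generatorK (s : S) : \val s * \val s = 1.
Proof.
have [[_ _ m1] _] := coxW; have ms : m s s = Some 1%N by apply/m1.
have /relator_eval1 : coxeter_relators m [:: (s, false); (s, false)].
  by exists s, s, 1%N.
by rewrite !geval_cons /geval big_nil mulg1.
Qed.

Lemma generatorV (s : S) : (\val s)^-1 = \val s.
Proof. exact/mulg1_eq/generatorK. Qed.

Lemma eval_word_rev r : eval_word (rev r) = (eval_word r)^-1.
Proof.
elim: r => [|s r IH]; first by rewrite eval_word_nil invg1.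
rewrite rev_cons -cats1 eval_word_cat IH !eval_word_cons eval_word_nil mulg1.
by rewrite invgM generatorV.
Qed.

Definition word_reflections r : seq W :=
  reflections gen (positive_word r).

Lemma word_reflections_cons s r : word_reflections (s :: r) =
  \val s :: [seq t ^ \val s | t <- word_reflections r].
Proof. by rewrite /word_reflections /= generatorV. Qed.

Lemma eval1_parity (u : gword S) t : geval gen u = 1 ->
  ~~ parity gen t u.
Proof.
move=> /coxW.2.2 u1; apply/negbT.
apply: (proj2 (pres_eq_parity _ u1) t) => _ [s [s' [k [mk ->]]]].
have ev : geval gen (alternating k s s') = 1.
  by apply: relator_eval1; exists s, s', k.
split=> // t'; apply: parity_alternating; [exact: generatorK..|].
by rewrite -[LHS](geval_alternating gen).
Qed.

(** Only words representing 1 are comparable through the presentation; closing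
both words by the reverse of the same r gives two such words, and the part of
the parity due to rev r is common to both. *)
Lemma eval_word_parity r r' t : eval_word r = eval_word r' ->
  odd (count_mem t (word_reflections r)) =
  odd (count_mem t (word_reflections r')).
Proof.
move=> rr'.
have par1 r0 : eval_word r0 = eval_word r ->
    parity gen t (positive_word r0) =
    parity gen (t ^ eval_word r) (positive_word (rev r)).
  move=> er0; apply/eqP.
  rewrite -negb_add -er0 -geval_positive_word -parity_cat.
  apply: eval1_parity; rewrite geval_cat !geval_positive_word eval_word_rev er0.
  by rewrite mulgV.
exact: etrans (par1 r erefl) (esym (par1 r' (esym rr'))).
Qed.

(** Multiplying s_1 ... s_k on the left by its i-th reflection deletes s_i. *)
Lemma strong_exchange r t : t \in word_reflections r ->
  exists r', [/\ size r = (size r').+1, {subset r' <= r} &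
    eval_word r' = t * eval_word r].
Proof.
elim: r t => [//|s r IH] t; rewrite word_reflections_cons inE => /orP[/eqP->|].
  exists r; split=> // [x xr|]; first by rewrite inE xr orbT.
  by rewrite eval_word_cons mulgA generatorK mul1g.
case/mapP => t' /IH[r' [sr sub er'] ->]; exists (s :: r'); split=> /=.
- by rewrite sr.
- by move=> x; rewrite !inE => /orP[->//|/sub->]; rewrite orbT.
- rewrite !eval_word_cons er' /conjg generatorV -!mulgA.
  by rewrite (mulgA (\val s) (\val s)) generatorK mul1g.
Qed.

(** Minimality among words with letters in P covers two uses: with P everything
it is reducedness, and with P = T it gives short words of an element of W_T
without leaving T, before one knows that reduced words stay in T. *)
Definition minimal_word P r : Prop := all P r /\
  forall r', all P r' -> eval_word r' = eval_word r -> (size r <= size r')%N.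

Lemma minimal_word_exists P r : all P r ->
  exists2 r', minimal_word P r' & eval_word r' = eval_word r.
Proof.
have [n] := ubnP (size r); elim: n r => // n IH r rn Pr.
case: (pselect (exists r', [/\ all P r', eval_word r' = eval_word r
                               & (size r' < size r)%N])).
  case=> r' [Pr' er' sr']; have [//||r'' mr'' er''] := IH r' => //.
    by apply: leq_trans sr' _; rewrite -ltnS.
  by exists r'' => //; rewrite er''.
move=> noshort; exists r => //; split=> // r' Pr' er'; rewrite leqNgt.
by apply/negP => sr'; apply: noshort; exists r'.
Qed.

(** If the reflection s of the first letter occurred again further on, the
exchange property would delete that first letter and a later one, giving a
shorter word with letters still in P. *)
Lemma minimal_word_uniq P r : minimal_word P r -> uniq (word_reflections r).
Proof.
elim: r => [//|s r IH]; rewrite word_reflections_cons.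
case=> [/= /andP[Ps Pr] minr].
have -> : \val s \notin [seq t ^ \val s | t <- word_reflections r].
  apply/negP => /mapP[t tr st].
  have ts : t = \val s.
    rewrite -[t](conjgK (\val s)) -st generatorV /conjg generatorV.
    by rewrite mulgA generatorK mul1g.
  have [r' [sr sub er']] := strong_exchange tr.
  have Pr' : all P r' by apply/allP => x /sub /(allP Pr).
  have := minr r' Pr'; rewrite er' ts eval_word_cons /= sr => /(_ erefl).
  by rewrite ltnNge leqnSn.
rewrite /= (map_inj_uniq (conjg_inj _)); apply: IH; split=> // r' Pr' er'.
by apply: (minr (s :: r')); rewrite /= ?Ps // !eval_word_cons er'.
Qed.

Lemma uniq_reflections_sub r r' : uniq (word_reflections r) ->
  eval_word r = eval_word r' ->
  {subset word_reflections r <= word_reflections r'}.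
Proof.
move=> ur er t tr; have := eval_word_parity t er.
rewrite count_uniq_mem // tr /= => /esym/odd_gt0.
by rewrite -has_count has_pred1.
Qed.

Lemma group_closed_val (H : set W) (closedH : group_closed (mem H)) :
  [/\ H 1, forall x y, H x -> H y -> H (x * y) & forall x, H x -> H x^-1].
Proof.
split.
- by have := closedH.1; rewrite inE.
- move=> x y /mem_set Hx /mem_set Hy.
  by have := group_closedM closedH Hx Hy; rewrite inE.
- by move=> x /mem_set Hx; have := group_closedV closedH Hx; rewrite inE.
Qed.

Lemma parabolic_closed (T : set S) : group_closed (mem (parabolic T)).
Proof.
split; first by rewrite inE => H [/group_closed_val[H1 _ _] _]; exact: H1.
move=> x y; rewrite !inE => Hx Hy H HT.
have [/group_closed_val[_ HM HV] _] := HT.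
exact: HM (Hx H HT) (HV _ (Hy H HT)).
Qed.

Lemma parabolic_gen (T : set S) (s : S) : T s -> parabolic T (\val s).
Proof. by move=> Ts; apply: sub_gen_smallest; exists s. Qed.

Lemma parabolicP (T : set S) w :
  parabolic T w <-> exists2 r, all (mem T) r & eval_word r = w.
Proof.
split; last first.
  have [T1 TM _] := group_closed_val (parabolic_closed T).
  case=> r + <-; elim: r => [|s r IH] /=; first by rewrite eval_word_nil.
  move=> /andP[/set_mem Ts /IH]; rewrite eval_word_cons; apply: TM.
  exact: parabolic_gen.
move=> /(_ [set w | exists2 r, all (mem T) r & eval_word r = w]); apply; split.
  split; first by rewrite inE; exists [::] => //; rewrite eval_word_nil.
  move=> x y; rewrite !inE => -[r Tr <-] [r' Tr' <-].
  exists (r ++ rev r'); first by rewrite all_cat all_rev Tr.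
  by rewrite eval_word_cat eval_word_rev.
move=> _ [s Ts <-]; exists [:: s]; first by rewrite /= mem_set.
by rewrite eval_word_cons eval_word_nil mulg1.
Qed.

(** A shortest word r of s with letters in T has distinct reflections, all of
them among the single reflection of the word [:: s]; so r has one letter, which
is s because distinct elements of S are distinct in W. *)
Lemma parabolic_generator (T : set S) (s : S) : parabolic T (\val s) -> T s.
Proof.
case/parabolicP => r0 /minimal_word_exists[r [Tr minr] er] er0.
have ers : eval_word r = eval_word [:: s].
  by rewrite er er0 eval_word_cons eval_word_nil mulg1.
have sr : \val s \in word_reflections r.
  by apply: (uniq_reflections_sub _ (esym ers)); rewrite ?mem_head.
have /= := uniq_leq_size (minimal_word_uniq (conj Tr minr))
  (uniq_reflections_sub (minimal_word_uniq (conj Tr minr)) ers).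
case: r Tr sr {minr er ers} => [//|x [|y r]]; last first.
  by rewrite !word_reflections_cons.
rewrite /= andbT word_reflections_cons mem_seq1.
by move=> /set_mem Tx /eqP/val_inj ->.
Qed.

Lemma word_reflections_parabolic (T : set S) r t :
  all (mem T) r -> t \in word_reflections r -> parabolic T t.
Proof.
have [_ TM _] := group_closed_val (parabolic_closed T).
elim: r t => [//|s r IH] t /andP[/set_mem/parabolic_gen Ts Tr].
rewrite word_reflections_cons inE.
case/orP=> [/eqP-> //|/mapP[t' /(IH _ Tr) Tt' ->]].
by rewrite /conjg generatorV; exact: TM Ts (TM _ _ Tt' Ts).
Qed.

(** The first reflection is the first letter, and conjugating the others by it
gives the reflections of the remaining word. *)
Lemma parabolic_letters (T : set S) r :
  (forall t, t \in word_reflections r -> parabolic T t) -> all (mem T) r.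
Proof.
have [_ TM _] := group_closed_val (parabolic_closed T).
elim: r => [//|s r IH] Tr; rewrite word_reflections_cons in Tr.
have Ts : parabolic T (\val s) by apply: Tr; rewrite mem_head.
apply/andP; split; first exact: mem_set (parabolic_generator Ts).
apply: IH => t tr; have Tts : parabolic T (t ^ \val s).
  by apply: Tr; rewrite in_cons orbC (map_f (fun u : W => u ^ \val s)).
rewrite -[t](conjgK (\val s)) generatorV conjgE generatorV.
exact: TM Ts (TM _ _ Tts Ts).
Qed.

Lemma reduced_word_parabolic (T : set S) w r :
  reduced_word w r -> parabolic T w -> all (mem T) r.
Proof.
move=> [erw minr] /parabolicP[r' Tr' er'w]; apply: parabolic_letters => t tr.
apply: (word_reflections_parabolic Tr').
apply: uniq_reflections_sub tr; last by rewrite erw er'w.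
apply: (@minimal_word_uniq predT); split; first exact: all_predT.
by move=> r0 _ er0; apply: minr; rewrite er0.
Qed.

Lemma reduced_word_exists w : exists r, reduced_word w r.
Proof.
have [u uw] := coxW.2.1 w.
have [r0 er0] : exists r0, eval_word r0 = w.
  exists (map fst u); rewrite -{}uw; elim: u => [|[s b] u IH] /=.
    by rewrite eval_word_nil /geval big_nil.
  by rewrite eval_word_cons geval_cons IH generatorV; case: b.
have [r [_ minr] er] := minimal_word_exists (all_predT r0).
exists r; split=> [|r' er']; first by rewrite er.
by apply: minr; rewrite ?all_predT // er er0.
Qed.

(** The set of letters of a reduced word does not depend on the word, because
the right-hand side does not mention it. *)
Lemma mem_reduced_word w r (s : S) :
  reduced_word w r -> s \in r <-> ~ parabolic [set~ s] w.
Proof.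
move=> rw; split=> [sr /(reduced_word_parabolic rw)/allP/(_ s sr)/set_mem|Nsw].
  by apply.
apply: contrapT => /negP sr; apply: Nsw.
apply/parabolicP; exists r; last by case: rw.
by apply/allP => x xr; apply: mem_set => xs; rewrite -xs xr in sr.
Qed.

Lemma colourP w (s : S) : colour w s <-> ~ parabolic [set~ s] w.
Proof.
split=> [[r rw] /(mem_reduced_word _ rw) //|Nsw].
have [r rw] := reduced_word_exists w.
by exists r => //; apply/(mem_reduced_word _ rw).
Qed.

Lemma finite_colour w : finite_set (colour (S := S) w).
Proof.
have [r rw] := reduced_word_exists w.
apply: (@sub_finite_set _ _ [set` r]); last exact: finite_seq.
by move=> s /colourP /(mem_reduced_word _ rw).
Qed.

Lemma riesz_coxeter_prod (R : realType) (q : S -> R) w (F : seq S) :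
  uniq F -> {subset fset_set (colour w) <= F} ->
  riesz_coxeter q w =
  (\prod_(s <- F) (if `[< parabolic [set~ s] w >] then 1 else q s))%R.
Proof.
move=> uF subF; rewrite (bigID (mem (fset_set (colour w)))) /=.
rewrite [X in (_ * X)%R]big1 ?mulr1 => [|s]; last first.
  rewrite in_fset_set ?inE; last exact: finite_colour.
  by move/negP; case: asboolP => // Nsw []; apply/mem_set/colourP.
rewrite -big_filter /riesz_coxeter.
transitivity (\prod_(s <- fset_set (colour w))
    (if `[< parabolic [set~ s] w >] then 1 else q s))%R.
  apply: eq_big_seq => s; rewrite in_fset_set; last exact: finite_colour.
  by move=> /set_mem/colourP; case: asboolP.
apply: perm_big; apply: uniq_perm; rewrite ?fset_uniq ?filter_uniq // => s.
by rewrite mem_filter; apply/idP/andP => [sw|[]//]; split=> //; apply: subF.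
Qed.

End CoxeterWords.

(** * Left cosets and the bound on the parameters *)

Section LeftCosets.
Local Open Scope group_scope.

Lemma left_coset_eq (W : groupType) (H : set W) (x y : W) :
  group_closed (mem H) ->
  ([set x * h | h in H] == [set y * h | h in H]) = `[< H (y^-1 * x) >].
Proof.
move=> /group_closed_val[H1 HM HV]; apply/eqP/asboolP => [xy|Hyx].
  have : [set x * h | h in H] x by exists 1; rewrite ?mulg1.
  by rewrite xy => -[h Hh <-]; rewrite mulKg.
apply/seteqP; split=> _ [h Hh <-].
  by exists (y^-1 * x * h); rewrite ?mulgA ?mulgV ?mul1g //; exact: HM.
exists (x^-1 * y * h); last by rewrite !mulgA mulgV mul1g.
by apply: HM => //; rewrite -[y]invgK -invgM; apply: HV.
Qed.

End LeftCosets.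

(** A finite set of points meets n <= d cosets, and -1/(n-1) <= -1/(d-1). When d
is infinite the bound q >= 0 serves for every n. For d = 1 the division by zero
in the bound also gives q >= 0. *)
Lemma riesz_bound_cosets (R : realType) (W : groupType) (H : set W)
    (A : seq W) (q : R) :
  riesz_bound R (subgroup_index H) <= q <= 1 ->
  0 <= 1 + ((size (undup [seq [set (x * h)%g | h in H] | x <- A]))%:R - 1) * q.
Proof.
case/andP; set L := undup _ => qge q1.
have [L0|L1] := posnP (size L); first by rewrite L0; lra.
have {}L1 : 1 <= (size L)%:R :> R by rewrite ler1n.
have [q0|q0] := leP 0 q; first by nra.
move: qge; rewrite /riesz_bound /subgroup_index.
case: asboolP => [fin|_]; last by lra.
have : (size L)%:R <= #|` fset_set (left_cosets H)|%:R :> R.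
  rewrite ler_nat; apply: uniq_leq_size; first exact: undup_uniq.
  move=> C; rewrite mem_undup in_fset_set // => /mapP[x _ ->].
  by apply: mem_set; exists x.
move: #|`_|%:R => d Ld; have [d1|d1] := eqVneq d 1.
  by rewrite d1 subrr invr0; lra.
have d1' : 0 < d - 1 by rewrite subr_gt0 lt_neqAle eq_sym d1; lra.
by rewrite ler_pdivrMr //; nra.
Qed.

(** * Positive semidefinite kernels on finitely many points *)

Section PositiveSemidefiniteKernels.
Variables (R : realType) (T : eqType).
Implicit Types (A : seq T) (K : T -> T -> R[i]).

Definition psd_kernel A K : Prop := forall alpha : T -> R[i],
  0 <= \sum_(x <- A) \sum_(y <- A) K x y * alpha x * (alpha y)^*%C.

Lemma eq_psd_kernel A K K' :
  {in A &, forall x y, K x y = K' x y} -> psd_kernel A K -> psd_kernel A K'.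
Proof.
move=> eqK pK alpha; have := pK alpha.
congr (0 <= _); apply: eq_big_seq => x xA; apply: eq_big_seq => y yA.
by rewrite eqK.
Qed.

Lemma psd_kernelD A K K' : psd_kernel A K -> psd_kernel A K' ->
  psd_kernel A (fun x y => K x y + K' x y).
Proof.
move=> pK pK' alpha; have := addr_ge0 (pK alpha) (pK' alpha).
congr (0 <= _); rewrite -big_split; apply: eq_bigr => x _ /=.
by rewrite -big_split; apply: eq_bigr => y _ /=; rewrite !mulrDl.
Qed.

(** The factor f(x) f(y) is absorbed by replacing alpha with f alpha. *)
Lemma psd_kernel_twist A K (f : T -> R) : psd_kernel A K ->
  psd_kernel A (fun x y => K x y * (f x * f y)%:C%C).
Proof.
move=> pK alpha; have := pK (fun x => (f x)%:C%C * alpha x).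
congr (0 <= _); apply: eq_bigr => x _; apply: eq_bigr => y _.
have -> : ((f y)%:C%C * alpha y)^*%C = (f y)%:C%C * (alpha y)^*%C.
  by rewrite rmorphM /= oppr0.
by rewrite rmorphM; ring.
Qed.

Lemma psd_kernelZ A K (c : R) : 0 <= c -> psd_kernel A K ->
  psd_kernel A (fun x y => K x y * c%:C%C).
Proof.
move=> c0 pK alpha; have c0' : 0 <= c%:C%C by rewrite lecR.
have := mulr_ge0 c0' (pK alpha).
congr (0 <= _); rewrite mulr_sumr; apply: eq_bigr => x _.
by rewrite mulr_sumr; apply: eq_bigr => y _; ring.
Qed.

Lemma psd_kernel1 A : psd_kernel A (fun _ _ => 1).
Proof.
move=> alpha; have := mul_conjC_ge0 (\sum_(x <- A) alpha x).
rewrite -[(_ ^*)%R]/(conjc _).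
congr (0 <= _); rewrite rmorph_sum mulr_suml; apply: eq_bigr => x _.
by rewrite mulr_sumr; apply: eq_bigr => y _; rewrite mul1r.
Qed.

Lemma psd_kernel_sum A K (I : Type) (r : seq I) (f : I -> T -> R) :
  psd_kernel A K ->
  psd_kernel A (fun x y => K x y * (\sum_(c <- r) f c x * f c y)%:C%C).
Proof.
move=> pK; elim: r => [|c r IH].
  apply: (eq_psd_kernel _ (psd_kernelZ (lexx 0) pK)) => x y _ _.
  by rewrite big_nil.
apply: (eq_psd_kernel _ (psd_kernelD (psd_kernel_twist (f c) pK) IH)).
move=> x y _ _.
by rewrite big_cons -mulrDr -rmorphD.
Qed.

(** The matrix with diagonal 1 - 1/n and other entries -1/n is the orthogonal
projection onto the sum-zero vectors, hence is its own Gram matrix. *)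
Lemma centred_indicator_gram (I : eqType) (L : seq I) (a b : I) :
  uniq L -> a \in L -> b \in L ->
  \sum_(c <- L) ((a == c)%:R - (size L)%:R^-1) *
                ((b == c)%:R - (size L)%:R^-1)
    = (a == b)%:R - (size L)%:R^-1 :> R.
Proof.
move=> uL aL bL; set n : R := (size L)%:R.
have n0 : n != 0 by rewrite pnatr_eq0; case: (L) aL.
have sum_eq d : d \in L -> \sum_(c <- L) (d == c)%:R = 1 :> R.
  move=> dL; rewrite (bigD1_seq d) //= eqxx big1 ?addr0 // => c.
  by rewrite eq_sym => /negPf ->.
have sum_mul : \sum_(c <- L) (a == c)%:R * (b == c)%:R = (a == b)%:R :> R.
  rewrite (bigD1_seq a) //= eqxx mul1r eq_sym big1 ?addr0 // => c.
  by rewrite eq_sym => /negPf ->; rewrite mul0r.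
transitivity (\sum_(c <- L) ((a == c)%:R * (b == c)%:R
   - n^-1 * (a == c)%:R - n^-1 * (b == c)%:R + n^-1 * n^-1)).
  by apply: eq_bigr => c _; ring.
rewrite !big_split /= !sumrN -!mulr_sumr sum_mul !sum_eq //.
rewrite big_const_seq count_predT iter_addr_0 -mulr_natl -/n.
by field.
Qed.

(** The matrix with 1 on the diagonal and q elsewhere has the eigenvalues 1 - q
and 1 + (n - 1) q; the two summands below are its spectral parts. *)
Lemma psd_kernel_labels (L : eqType) A K (g : T -> L) (q : R) :
  0 <= 1 + ((size (undup (map g A)))%:R - 1) * q -> q <= 1 ->
  psd_kernel A K ->
  psd_kernel A (fun x y => K x y * (if g x == g y then 1 else q)%:C%C).
Proof.
set l := undup _ => q_ge q_le1 pK; set n : R := (size l)%:R.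
pose f c x : R := (g x == c)%:R - n^-1.
have b0 : 0 <= (1 + (n - 1) * q) / n by rewrite divr_ge0.
have a0 : 0 <= 1 - q by rewrite subr_ge0.
have := psd_kernelD (psd_kernelZ a0 (psd_kernel_sum l f pK))
                    (psd_kernelZ b0 pK).
apply: eq_psd_kernel => x y xA yA.
have gl z : z \in A -> g z \in l by move=> zA; rewrite mem_undup map_f.
have n0 : n != 0 by rewrite pnatr_eq0; case: (l) (gl _ xA).
rewrite /f centred_indicator_gram ?undup_uniq ?gl // -/n.
rewrite -mulrA -rmorphM -mulrDr -rmorphD; congr (_ * _%:C%C).
by case: eqP => _ /=; field.
Qed.

End PositiveSemidefiniteKernels.

(** * Positive definiteness of the Riesz-Coxeter function *)

Theorem theorem6p2 (R : realType) (W : groupType) (S : set W)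
    (m : S -> S -> option nat) (hWS : coxeter_system m)
    (q : S -> R)
    (hq : forall s : S,
      riesz_bound R (subgroup_index (parabolic [set~ s])) <= q s <= 1) :
  positive_definite (fun w : W => (riesz_coxeter q w)%:C%C).
Proof.
move=> alpha; set A : seq W := finsupp alpha.
(* F collects all letters of the elements y^-1 x, so that a single finite
   product computes R_q at all of them. *)
pose colours (x y : W) : seq S := fset_set (colour (S := S) (y^-1 * x)%g).
pose F : seq S := undup (flatten [seq colours x y | x <- A, y <- A]).
suff psdR : psd_kernel A (fun x y => (riesz_coxeter q (y^-1 * x)%g)%:C%C).
  exact: psdR.
apply: (@eq_psd_kernel _ _ _ (fun x y => (\prod_(s <- F)
    (if `[< parabolic [set~ s] (y^-1 * x)%g >] then 1 else q s))%:C%C)).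
  move=> x y xA yA.
  rewrite (@riesz_coxeter_prod W S m hWS R q _ F) ?undup_uniq // => s sxy.
  rewrite mem_undup; apply/flattenP; exists (colours x y) => //.
  by apply/allpairsP; exists (x, y).
elim: F => [|s F IH].
  by apply: (eq_psd_kernel _ (psd_kernel1 A)) => x y _ _; rewrite big_nil.
have q1 : q s <= 1 by case/andP: (hq s).
have := psd_kernel_labels (riesz_bound_cosets A (hq s)) q1 IH.
apply: eq_psd_kernel => x y _ _.
rewrite left_coset_eq; last exact: parabolic_closed.
by rewrite big_cons -rmorphM mulrC.
Qed.
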